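(* Let $k\geq 1$ be an integer. For integers $m_1,\dots,m_k$ and $n\geq 1$, let $\mathcal{U}_k(m_1,\dots,m_k;n)$ denote the number of $k$-marked strongly unimodal symbols of size $n$ whose $j$th rank equals $m_j$ for every $1\leq j\leq k$. Then, as an identity of formal power series in $q$ (with coefficients Laurent polynomials in $x_1,\dots,x_k$), \[ \sum_{m_1,\dots,m_k \in \mathbb{Z}}\ \sum_{n\geq 1} \mathcal{U}_k(m_1, \dots, m_k; n)\, x_1^{m_1}\cdots x_k^{m_k}q^n = U_k(x_1,\dots, x_k; q), \] where \begin{multline*} U_k(x_1,\dots, x_k; q) := \sum_{m_1,\dots, m_k \geq 1} q^{M_1 + \cdots + M_{k}} \prod_{j=1}^{k-1}\left(1+x_j^{-1}q^{M_j}\right) \\ \cdot (-x_1q;q)_{m_1-1}(-x_1^{-1}q;q)_{m_1-1}\prod_{j=2}^{k}(-x_jq^{M_{j-1}+1};q)_{m_j-1}(-x_j^{-1}q^{M_{j-1}+1};q)_{m_j-1}, \end{multline*} with $M_j:= m_1 + m_2 + \cdots + m_j$ for $1\leq j \leq k$ (empty products equal $1$).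
   Context: Notation: $(a;q)_n:=\prod_{i=1}^{n}(1-aq^{i-1})$ for $n\ge 0$ (so $(a;q)_0=1$). A strongly unimodal sequence of size $n$ is a finite list of positive integers $a_1<a_2<\cdots<a_r>a_{r+1}>\cdots>a_s$ summing to $n$; $a_r$ is the peak. Such a sequence is encoded by its strongly unimodal symbol: the peak size $P=a_r$ (written as a subscript), a top row listing the parts to the right of the peak ($a_{r+1}>\cdots>a_s$) and a bottom row listing the parts to the left of the peak in decreasing order ($a_{r-1}>\cdots>a_1$). Thus the symbol consists of $P\ge1$ and two strictly decreasing (possibly empty) sequences of positive integers less than $P$; its size is $P$ plus the sum of all parts in both rows. A $k$-marked strongly unimodal symbol is a strongly unimodal symbol in which every part in both rows carries a subscript (mark) from $\{1,\dots,k\}$ (for $k=1$ all marks are $1$ and there are no further conditions). When $k\geq 2$ the following are additionally required: (1) in each row the parts are strictly decreasing and the subscripts are nonincreasing (reading left to right); (2) in the top row each of $1,2,\dots,k-1$ appears as the subscript of some part; (3) letting $M_j$ be the largest part with subscript $j$ in the top row ($1\le j\le k-1$), $M_0:=0$, and $M_k$ the peak size, all parts in the bottom row with subscript $j\in\{1,\dots,k-1\}$ lie in $[M_{j-1}+1,M_j]$, and those with subscript $k$ lie in $[M_{k-1}+1,M_k-1]$. Ranks: for such a symbol $\gamma$, let $\alpha^j$ and $\beta^j$ be the collections of parts with subscript $j$ in the top and bottom rows respectively, and $\ell(\cdot)$ the number of parts. The $j$th rank is $\rho_j(\gamma)=\ell(\alpha^j)-\ell(\beta^j)-1$ for $j<k$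 and $\rho_k(\gamma)=\ell(\alpha^k)-\ell(\beta^k)$. *)

(* Defs.v *)
From HB Require Import structures.
From mathcomp Require Import all_boot all_order all_algebra.
From mathcomp Require Import finmap boolp classical_sets cardinality fsbigop.
From mathcomp Require Import mpoly.

Set Implicit Arguments.
Unset Strict Implicit.
Unset Printing Implicit Defensive.

Import GRing.Theory.

Local Open Scope classical_set_scope.
Local Open Scope ring_scope.

(* A part is a pair (value, mark); a row lists its parts from left to right.
   Marks are the integers 1, ..., k, as on paper. *)
Definition row := seq (nat * nat).

Record symbol := Symbol { peak : nat; top : row; bottom : row }.

Definition symbol_tuple (g : symbol) : nat * row * row :=
  (peak g, top g, bottom g).
Definition tuple_symbol (t : nat * row * row) : symbol :=
  Symbol t.1.1 t.1.2 t.2.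
Lemma symbol_tupleK : cancel symbol_tuple tuple_symbol.
Proof. by case. Qed.
HB.instance Definition _ := Choice.copy symbol (can_type symbol_tupleK).

Section MarkedSymbols.

Local Open Scope nat_scope.

Definition parts (r : row) : seq nat := map fst r.
Definition marks (r : row) : seq nat := map snd r.

Definition strictly_unimodal_symbol (g : symbol) : bool :=
  [&& 1 <= peak g,
      sorted gtn (parts (top g)),
      all (fun a => 1 <= a < peak g) (parts (top g)),
      sorted gtn (parts (bottom g)) &
      all (fun a => 1 <= a < peak g) (parts (bottom g))].

(* The bounds M_0 = 0, M_j = largest part of mark j in the top row for
   1 <= j <= k - 1, and M_k = peak. *)
Definition mark_bound (k : nat) (g : symbol) (j : nat) : nat :=
  if j == 0 then 0
  else if j == k then peak g
  else \max_(p <- top g | p.2 == j) p.1.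

Definition mark_interval (k : nat) (g : symbol) (j a : nat) : bool :=
  if j == k then (mark_bound k g k.-1).+1 <= a <= (mark_bound k g k).-1
  else (mark_bound k g j.-1).+1 <= a <= mark_bound k g j.

Definition marked_symbol (k : nat) (g : symbol) : bool :=
  [&& strictly_unimodal_symbol g,
      all (fun j => 1 <= j <= k) (marks (top g)),
      all (fun j => 1 <= j <= k) (marks (bottom g)) &
      (2 <= k) ==>
        [&& sorted geq (marks (top g)),
            sorted geq (marks (bottom g)),
            all (fun j => j \in marks (top g)) (iota 1 k.-1) &
            all (fun p => mark_interval k g p.2 p.1) (bottom g)]].

Definition symbol_size (g : symbol) : nat :=
  peak g + sumn (parts (top g)) + sumn (parts (bottom g)).

Definition num_marked (r : row) (j : nat) : nat := count_mem j (marks r).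

End MarkedSymbols.

Definition symbol_rank (k : nat) (g : symbol) (j : nat) : int :=
  (num_marked (top g) j)%:Z - (num_marked (bottom g) j)%:Z
    - (if (j < k)%N then 1 else 0).

(* The index j : 'I_k stands for the 1-based index j.+1 throughout. *)
Definition symbols_with_ranks (k : nat) (m : {ffun 'I_k -> int}) (n : nat) :
    set symbol :=
  [set g | [/\ marked_symbol k g, symbol_size g = n &
               forall j : 'I_k, symbol_rank k g j.+1 = m j]].

(* [fset_set] sends infinite sets to the empty one; this is harmless here. *)
Lemma finite_symbols_with_ranks (k : nat) (m : {ffun 'I_k -> int}) (n : nat) :
  finite_set (symbols_with_ranks m n).
Proof.
pose B := n.+1.-bseq ('I_n.+1 * 'I_k.+1)%type.
pose dec (r : B) : row := [seq (val p.1, val p.2) | p <- r].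
pose f (t : 'I_n.+1 * B * B) := Symbol t.1.1 (dec t.1.2) (dec t.2).
apply: (@sub_finite_set _ _ (f @` setT)); last first.
  by apply: finite_image; exact: finite_finset.
have row_dec r : all (fun a => 1 <= a)%N (parts r) ->
    all (fun j => 1 <= j <= k)%N (marks r) ->
    (sumn (parts r) <= n)%N -> exists b : B, dec b = r.
  move=> r1 rk rn.
  have sz : (size r <= n)%N.
    apply: leq_trans rn; elim: r r1 {rk} => //= p r IHr /andP[p1 r1].
    by rewrite -add1n leq_add // IHr.
  pose c := [seq ((inord p.1 : 'I_n.+1), (inord p.2 : 'I_k.+1)) | p <- r].
  have cB : (size c <= n.+1)%N by rewrite size_map leqW.
  exists (Bseq cB); rewrite /dec /= /c -map_comp.
  elim: r r1 rk rn {sz c cB} => //= -[a j] r IHr /=.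
  move=> /andP[a1 r1] /andP[/andP[j1 jk] rk] rn.
  rewrite IHr ?(leq_trans (leq_addl _ _) rn) // !inordK //.
  by rewrite ltnS (leq_trans (leq_addr _ _) rn).
move=> [P t b] [/and4P[/and5P[/= P1 _ tP _ bP] /= tk bk _] /= sn _].
have pos r : all (fun a => 1 <= a < P)%N (parts r) ->
    all (fun a => 1 <= a)%N (parts r).
  by move=> rP; apply: sub_all rP => a /andP[].
rewrite /symbol_size /= in sn.
have [|ct ctE] := row_dec t (pos _ tP) tk.
  by rewrite -sn -addnA addnCA leq_addr.
have [|cb cbE] := row_dec b (pos _ bP) bk.
  by rewrite -sn leq_addl.
have Pn : (P < n.+1)%N by rewrite ltnS -sn -addnA leq_addr.
by exists (Ordinal Pn, ct, cb) => //; rewrite /f /= ctE cbE.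
Qed.

Definition num_symbols (k : nat) (m : {ffun 'I_k -> int}) (n : nat) : nat :=
  #|` fset_set (symbols_with_ranks m n)|.

(* Formal power series in q are coefficient sequences [nat -> R], and 'X plays
   the role of q. A family of polynomials in q is summable when each power of
   q receives finitely many nonzero contributions. Without summability,
   [fps_sum] takes the junk value 0 at the offending coefficients. *)
Definition fps_summable (R : nzRingType) (I : choiceType) (D : set I)
    (F : I -> {poly R}) : Prop :=
  forall n, finite_set [set i | D i /\ (F i)`_n != 0].

Definition fps_sum (R : nzRingType) (I : choiceType) (D : set I)
    (F : I -> {poly R}) : nat -> R :=
  fun n => \sum_(i \in D) (F i)`_n.

Definition qpoch (R : comNzRingType) (a q : R) (n : nat) : R :=
  \prod_(1 <= i < n.+1) (1 - a * q ^+ i.-1).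

Section RankSeries.

Variables (R : fieldType) (k : nat) (x : 'I_k -> R).

(* M_j = m_1 + ... + m_j *)
Definition partial_sum (m : {ffun 'I_k -> nat}) (j : nat) : nat :=
  (\sum_(i < k | i < j) m i)%N.

Definition Uk_term (m : {ffun 'I_k -> nat}) : {poly R} :=
  let M := partial_sum m in
  'X^(\sum_(1 <= j < k.+1) M j)%N
  * \prod_(j < k | (j.+1 < k)%N) (1 + (x j)^-1 *: 'X^(M j.+1))
  * \prod_(j < k | j == 0 :> nat)
      (qpoch (- (x j *: 'X)) 'X (m j).-1
       * qpoch (- ((x j)^-1 *: 'X)) 'X (m j).-1)
  * \prod_(j < k | (0 < j)%N)
      (qpoch (- (x j *: 'X^((M j).+1))) 'X (m j).-1
       * qpoch (- ((x j)^-1 *: 'X^((M j).+1))) 'X (m j).-1).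

Definition Uk_index : set {ffun 'I_k -> nat} :=
  [set m | forall j, (1 <= m j)%N].

Definition Uk : nat -> R := fps_sum Uk_index Uk_term.

Definition rank_index : set ({ffun 'I_k -> int} * nat) :=
  [set p | (1 <= p.2)%N].

Definition rank_term (p : {ffun 'I_k -> int} * nat) : {poly R} :=
  ((num_symbols p.1 p.2)%:R * \prod_(j < k) x j ^ p.1 j) *: 'X^(p.2).

End RankSeries.

(* Laurent polynomials in x_1, ..., x_k are taken inside the field of rational
   functions, which contains the Laurent polynomial ring. *)
Definition laurent_var (k : nat) (i : 'I_k) : {fraction {mpoly int[k]}} :=
  tofrac 'X_i.

(* Main.v *)
Require Import Defs.
From mathcomp Require Import all_boot all_order all_algebra.
From mathcomp Require Import finmap boolp classical_sets cardinality fsbigop.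
From mathcomp Require Import mpoly.
From mathcomp Require Import functions zify ring.

(* Fix the bounds 0 = M_0 < M_1 < ... < M_k of a k-marked symbol, M_k being the
   peak. A part of mark j lies in (M_(j-1), M_j] in either row, so the marks are
   determined by the values of the parts, and a symbol with these bounds amounts
   to two arbitrary sets of integers in [1, M_k), the top one containing
   M_1, ..., M_(k-1). Summing over the two sets gives
     q^(M_k) prod_(1 <= a < M_k) T_a (1 + x_j^-1 q^a),
   where j is the mark of a, T_a = x_j q^a when a = M_j and T_a = 1 + x_j q^a
   otherwise; the terms -1 in the ranks contribute the factor
   prod_(j < k) x_j^-1. Grouping the factors by mark, this is the summand of U_k
   at m_j = M_j - M_(j-1). *)

Set Implicit Arguments.
Unset Strict Implicit.
Unset Printing Implicit Defensive.

Import GRing.Theory.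

(** * Finitely supported sums grouped by the fibres of a map *)

Section FiniteSupportSums.

Local Open Scope classical_set_scope.
Local Open Scope ring_scope.

Lemma fsbig_partition (R : nmodType) (I J : choiceType) (A : set I)
    (D : set J) (f : I -> J) (w : I -> R) :
  finite_set A -> (forall i, A i -> D (f i)) ->
  \sum_(j \in D) \sum_(i \in A `&` f @^-1` [set j]) w i = \sum_(i \in A) w i.
Proof.
move=> finA AD.
rewrite -(@fsbig_widen _ _ _ _ (f @` A)); first last.
- move=> j [_ /= Nj]; apply: fsbig1 => i [Ai /= fij].
  by case: Nj; exists i.
- by move=> _ [i Ai <-]; apply: AD.
under eq_fsbigr do rewrite fsbig_mkcondr.
rewrite exchange_fsbig //; last exact: finite_image.
apply: eq_fsbigr => i /set_mem Ai.
rewrite -(@fsbig_widen _ _ _ _ [set f i]).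
- by rewrite fsbig_set1 ifT // inE.
- by move=> _ ->; exists i.
- by move=> j [_ /= Nj]; rewrite ifF //; apply/negP; rewrite inE => /esym.
Qed.

Lemma finite_fiber_sum_support (R : nmodType) (I J : choiceType) (A : set I)
    (D : set J) (f : I -> J) (w : I -> R) :
  finite_set A ->
  finite_set [set j | D j /\ \sum_(i \in A `&` f @^-1` [set j]) w i != 0].
Proof.
move=> finA; apply: (sub_finite_set _ (finite_image f finA)) => j [_].
apply: contraNP => Nj; apply/eqP; apply: fsbig1 => i [Ai /= fij].
by case: Nj; exists i.
Qed.

End FiniteSupportSums.

(** * The mark that a sequence of bounds assigns to an integer *)

Section Marks.

Local Open Scope nat_scope.

Variables (k : nat) (M : nat -> nat).

(** The search list starts at 0, so the position returned by [find] is the mark itself. When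
    [M 0 = 0], a positive [a] never gets mark 0. *)
Definition mark_of (a : nat) : nat :=
  find (fun j => a <= M j) (iota 0 k.+1).

Hypothesis M0 : M 0 = 0.
Hypothesis M_lt : forall j, j < k -> M j < M j.+1.

Lemma bounds_le i j : i <= j -> j <= k -> M i <= M j.
Proof.
elim: j => [|j IHj]; first by rewrite leqn0 => /eqP ->.
rewrite leq_eqVlt => /predU1P[-> //|ij jk].
by rewrite (leq_trans (IHj ij (ltnW jk))) // ltnW // M_lt.
Qed.

Lemma mark_ofP a : 0 < a <= M k ->
  0 < mark_of a <= k /\ M (mark_of a).-1 < a <= M (mark_of a).
Proof.
move=> /andP[a0 aM].
have hask : has (fun j => a <= M j) (iota 0 k.+1).
  by apply/hasP; exists k => //; rewrite mem_iota /= ltnSn.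
have lek : mark_of a < k.+1 by rewrite -[k.+1](size_iota 0) -has_find.
have leM : a <= M (mark_of a).
  by have := nth_find 0 hask; rewrite nth_iota.
have m0 : 0 < mark_of a.
  by rewrite lt0n; apply/eqP => m0; move: leM; rewrite m0 M0; lia.
split; first by rewrite m0.
rewrite leM andbT ltnNge.
have pm : (mark_of a).-1 < mark_of a by rewrite prednK.
have := before_find 0 pm; rewrite nth_iota /=; last by lia.
by move=> ->.
Qed.

(** The intervals cut out by increasing bounds are disjoint. *)
Lemma mark_of_unique a j : 0 < j <= k -> M j.-1 < a <= M j -> mark_of a = j.
Proof.
move=> /andP[j0 jk] /andP[Ma aM].
have [|/andP[m0 mk] /andP[Mm mM]] := @mark_ofP a.
  by have := bounds_le jk (leqnn k); lia.
case: (ltngtP (mark_of a) j) => // lt.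
- have : M (mark_of a) <= M j.-1 by apply: bounds_le; lia.
  lia.
- have : M j <= M (mark_of a).-1 by apply: bounds_le; lia.
  lia.
Qed.

Lemma mark_of_le a b : 0 < a -> a <= b -> b <= M k -> mark_of a <= mark_of b.
Proof.
move=> a0 ab bM.
have [|/andP[ma0 mak] /andP[Ma aMa]] := @mark_ofP a; first by lia.
have [|/andP[mb0 mbk] /andP[Mb aMb]] := @mark_ofP b; first by lia.
rewrite leqNgt; apply/negP => lt.
have : M (mark_of b) <= M (mark_of a).-1 by apply: bounds_le; lia.
lia.
Qed.

Lemma mark_of_bound j : 0 < j <= k -> mark_of (M j) = j.
Proof.
move=> j0; apply: mark_of_unique => //; rewrite leqnn andbT.
by case: j j0 => // j /= jk; rewrite M_lt.
Qed.

End Marks.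

(** * Rows whose marks are a function of the values *)

Section Rows.

Local Open Scope nat_scope.

(* The set of parts is encoded by its indicator on [0, N); the index [i] stands
   for the part [i.+1]. *)
Definition row_of (N : nat) (mk : nat -> nat) (s : pred 'I_N) : Defs.row :=
  [seq ((val i).+1, mk (val i).+1) | i <- rev (enum 'I_N) & s i].

Definition marked_by (N : nat) (mk : nat -> nat) (r : Defs.row) : bool :=
  all (fun p => (0 < p.1 <= N) && (p.2 == mk p.1)) r.

Definition canonical_row (N : nat) (mk : nat -> nat) (r : Defs.row) : bool :=
  sorted gtn (parts r) && marked_by N mk r.

Lemma parts_row_of N mk (s : pred 'I_N) (i : 'I_N) :
  ((val i).+1 \in parts (row_of mk s)) = s i.
Proof.
rewrite /parts /row_of -map_comp.
rewrite (mem_map (f := fun i : 'I_N => (val i).+1)).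
  by rewrite mem_filter mem_rev mem_enum andbT.
by move=> u v [/val_inj].
Qed.

Lemma sorted_row_of N mk (s : pred 'I_N) : sorted gtn (parts (row_of mk s)).
Proof.
rewrite /parts /row_of -map_comp sorted_map.
apply: sorted_filter; first by move=> a b c /=; lia.
rewrite rev_sorted.
by have := iota_ltn_sorted 0 N; rewrite -val_enum_ord sorted_map.
Qed.

Lemma canonical_row_of N mk (s : pred 'I_N) : canonical_row N mk (row_of mk s).
Proof.
rewrite /canonical_row sorted_row_of; apply/allP => p /mapP[i _ ->] /=.
by rewrite ltn_ord eqxx.
Qed.

(** The marks carry no information beyond the values, and two strictly decreasing lists with the
    same elements coincide. *)
Lemma canonical_rowE N mk r : canonical_row N mk r ->
  r = row_of mk (fun i : 'I_N => (val i).+1 \in parts r).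
Proof.
move=> /andP[rs rc].
have rE (r' : Defs.row) : marked_by N mk r' ->
    r' = [seq (a, mk a) | a <- parts r'].
  elim: r' => //= -[a j] r' IHr /andP[/andP[_ /eqP /= ->] /IHr {1}->] //.
set s := fun i => _.
have /andP[ss sc] := canonical_row_of mk s.
rewrite [LHS]rE // [RHS]rE //; congr map.
apply: (irr_sorted_eq (leT := gtn)) => //.
- by move=> a b c /=; lia.
- by move=> a /=; lia.
move=> a; apply/idP/idP => ar.
  have /mapP[[b j] /(allP rc)/andP[/andP[/= b0 bN] _] /= ab] := ar; subst b.
  have aN : a.-1 < N by lia.
  by have := parts_row_of mk s (Ordinal aN); rewrite /s /= prednK // ar.
have /mapP[[b j] /(allP sc)/andP[/andP[/= b0 bN] _] /= ab] := ar; subst b.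
have aN : a.-1 < N by lia.
by have := parts_row_of mk s (Ordinal aN); rewrite /s /= prednK // ar => <-.
Qed.

Lemma sumn_row_of N mk (s : pred 'I_N) :
  sumn (parts (row_of mk s)) = \sum_(i < N | s i) i.+1.
Proof.
rewrite /parts /row_of -map_comp sumnE big_map big_filter.
by rewrite (perm_big _ (permEl (perm_rev _))) big_enum_cond.
Qed.

Lemma prod_row_of (R : comNzRingType) (y : nat -> R) N mk (s : pred 'I_N) :
  (\prod_(p <- row_of mk s) y p.2 = \prod_(i < N | s i) y (mk i.+1))%R.
Proof.
rewrite /row_of big_map big_filter /=.
by rewrite (perm_big _ (permEl (perm_rev _))) big_enum_cond.
Qed.

End Rows.

(** * Marked symbols with given bounds, characterized by canonical rows *)

Section MarkedSymbolStructure.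

Local Open Scope nat_scope.

Lemma sorted_row_mark_le (r : Defs.row) (p p' : nat * nat) :
  sorted gtn (parts r) -> sorted geq (marks r) ->
  p \in r -> p' \in r -> p.1 <= p'.1 -> p.2 <= p'.2.
Proof.
rewrite /parts /marks !sorted_map !sorted_pairwise; first last.
- by move=> a b c /=; lia.
- by move=> a b c /=; lia.
elim: r => //= x r IHr /andP[/allP x1 r1] /andP[/allP x2 r2].
rewrite !inE => /predU1P[->|pr] /predU1P[->|p'r] le //.
- by have /= := x1 _ p'r; lia.
- exact: x2 _ pr.
- exact: IHr.
Qed.

(** Some top part has mark [j], so the maximum is attained and is not the default 0 of an empty
    [\max]. *)
Lemma bound_part_mem k g j : marked_symbol k g -> 0 < j < k ->
  (mark_bound k g j, j) \in top g.
Proof.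
move=> /and4P[_ _ _ /implyP H] /andP[j0 jk].
have /and4P[_ _ /allP allj _] : _ := H (leq_ltn_trans j0 jk).
have /mapP[p pt pj] : j \in marks (top g) by apply: allj; rewrite mem_iota; lia.
rewrite /mark_bound ifN_eqC; last by lia.
rewrite ifN_eq; last by lia.
have max_eq (r : Defs.row) : p \in r ->
    (\max_(q <- r | q.2 == j) q.1, j) \in r.
  move=> pr; rewrite -big_filter.
  have: has (fun q => q.2 == j) r by apply/hasP; exists p => //; rewrite pj.
  rewrite has_filter; set s := filter _ r => s0.
  have sr : {subset s <= [seq q <- r | q.2 == j]} by [].
  suff /mapP[q /sr] : \max_(q <- s) q.1 \in map fst s.
    rewrite mem_filter => /andP[/eqP qj qr] ->.
    by move: qr; rewrite -qj -surjective_pairing.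
  elim: s s0 {sr} => // q [|q' s] IHs _.
    by rewrite big_seq1 mem_seq1.
  rewrite big_cons inE.
  have := IHs isT; set b := \max_(_ <- _) _ => bs.
  by case: (leqP q.1 b) => _; rewrite ?eqxx // bs orbT.
exact: max_eq.
Qed.

(** The definition imposes intervals on the bottom row only. In the top row they follow from the
    order of the marks: a part not exceeding the bound of the previous mark, itself a top part,
    would have at most that previous mark. *)
Lemma top_mark_interval k g p : marked_symbol k g -> p \in top g ->
  mark_bound k g p.2.-1 < p.1 <= mark_bound k g p.2.
Proof.
move=> gk pt; have := gk.
move=> /and4P[/and5P[P1 st tP _ _] /allP tk _ /implyP H].
have /andP[p0 pk] := tk _ (map_f snd pt).
have /andP[p10 pP] := allP tP _ (map_f fst pt).
apply/andP; split; last first.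
  rewrite /mark_bound ifN_eq -?lt0n //.
  case: eqP => _; first exact: ltnW.
  by rewrite (leq_bigmax_seq (F := fst)).
have [p1|p1] := leqP p.2 1.
  by have -> : p.2 = 1 by lia.
have bt : (mark_bound k g p.2.-1, p.2.-1) \in top g.
  by apply: bound_part_mem => //; lia.
rewrite ltnNge; apply/negP => le.
have /and4P[sm _ _ _] := H (leq_trans p1 pk).
have := sorted_row_mark_le st sm pt bt le.
by rewrite /= leqNgt prednK; [rewrite leqnn|exact: ltnW].
Qed.

Lemma mark_bound_peak k g : 0 < k -> mark_bound k g k = peak g.
Proof. by case: k => // k _; rewrite /mark_bound eqxx. Qed.

(** Below the peak, the bound of mark [j.+1] is a top part of that mark and so exceeds the previous
    bound. At [j.+1 = k], the previous bound is 0 or a top part, hence below the peak. *)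
Lemma mark_bound_lt k g j : marked_symbol k g -> j < k ->
  mark_bound k g j < mark_bound k g j.+1.
Proof.
move=> gk jk; have /and4P[/and5P[P1 st tP _ _] _ _ _] := gk.
have [jk1|jk1] := ltnP j.+1 k.
  have bt : (mark_bound k g j.+1, j.+1) \in top g by exact: bound_part_mem.
  by have /andP[] := top_mark_interval gk bt.
have -> : j.+1 = k by lia.
rewrite mark_bound_peak; last by lia.
case: j jk jk1 => // j jk _.
have bt : (mark_bound k g j.+1, j.+1) \in top g by apply: bound_part_mem.
by have /andP[] := allP tP _ (map_f fst bt).
Qed.

Lemma leq_predE P a : 0 < P -> (a <= P.-1) = (a < P).
Proof. by move=> P0; rewrite -ltnS prednK. Qed.

(** Every part of either row lies in the interval of its mark, and that interval determines the
    mark. *)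
Lemma marked_symbol_canonical k M g : 0 < k ->
  marked_symbol k g -> (forall j, j <= k -> mark_bound k g j = M j) ->
  [/\ peak g = M k,
      canonical_row (M k).-1 (mark_of k M) (top g),
      canonical_row (M k).-1 (mark_of k M) (bottom g) &
      forall j, 0 < j < k -> M j \in parts (top g)].
Proof.
move=> k0 gk gM.
have M0 : M 0 = 0 by rewrite -gM.
have M_lt j : j < k -> M j < M j.+1.
  by move=> jk; have := mark_bound_lt gk jk; rewrite !gM // ltnW.
have peakM : peak g = M k by rewrite -gM // mark_bound_peak.
have /and4P[/and5P[P1 st tP sb bP] /allP tk /allP bk /implyP H] := gk.
have M_ge : 0 < M k by rewrite -peakM.
have in_range j : 0 < j <= k -> j.-1 <= k /\ j <= k.
  by move=> /andP[_ jk]; rewrite (leq_trans (leq_pred _) jk).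
split=> //.
- rewrite /canonical_row st; apply/allP => -[a i] pt.
  have aP : 0 < a < M k by rewrite -peakM; exact: allP tP _ (map_f fst pt).
  rewrite /= leq_predE // aP /=.
  have /= pk := tk _ (map_f snd pt).
  have [ik1 ik] := in_range _ pk.
  have /= := top_mark_interval gk pt; rewrite !gM // => pI.
  by rewrite (mark_of_unique M0 M_lt pk pI) eqxx.
- rewrite /canonical_row sb; apply/allP => -[a i] pb.
  have aP : 0 < a < M k by rewrite -peakM; exact: allP bP _ (map_f fst pb).
  rewrite /= leq_predE // aP /=.
  have /= pk := bk _ (map_f snd pb).
  have [ik1 ik] := in_range _ pk.
  suff pI : M i.-1 < a <= M i by rewrite (mark_of_unique M0 M_lt pk pI) eqxx.
  (* The interval condition on the bottom row is imposed for [k >= 2] only. For [k = 1] the single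
     interval runs from 1 to the peak and contains every part. *)
  have [k2|k1] := leqP 2 k.
    have /and4P[_ _ _ /allP /(_ _ pb)] := H k2.
    rewrite /mark_interval /=; case: eqP => [ij|_]; last by rewrite !gM.
    by rewrite ij !gM ?leq_pred // leq_predE // => /andP[-> /ltnW].
  have [-> k1'] : i = 1 /\ k = 1 by move: k0 k1 pk; clear; lia.
  by move: aP; rewrite M0 k1' => /andP[-> /ltnW].
- move=> j /andP[j0 jk]; rewrite -gM 1?ltnW //.
  by apply: (map_f fst (bound_part_mem gk _)); rewrite j0.
Qed.

(** Converse direction: [mark_of] is monotone, so decreasing values force nonincreasing marks, and
    the prescribed parts [M j] make every mark below [k] occur in the top row. *)
Lemma canonical_marked_symbol k M g : 0 < k ->
  M 0 = 0 -> (forall j, j < k -> M j < M j.+1) ->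
  peak g = M k ->
  canonical_row (M k).-1 (mark_of k M) (top g) ->
  canonical_row (M k).-1 (mark_of k M) (bottom g) ->
  (forall j, 0 < j < k -> M j \in parts (top g)) ->
  marked_symbol k g /\ forall j, j <= k -> mark_bound k g j = M j.
Proof.
move=> k0 M0 M_lt peakM /andP[st ct] /andP[sb cb] tM.
have Mk0 : 0 < M k.
  by have := M_lt _ k0; have := bounds_le M_lt k0 (leqnn k); lia.
have canP (r : Defs.row) p :
    marked_by (M k).-1 (mark_of k M) r ->
    p \in r ->
    [/\ 0 < p.1 < M k, p.2 = mark_of k M p.1, 0 < p.2 <= k &
        M p.2.-1 < p.1 <= M p.2].
  case: p => a i /allP cr /cr /=; rewrite leq_predE // => /andP[aM /eqP ia].
  have [|] := @mark_ofP k M M0 a; first by case/andP: aM => -> /ltnW.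
  by rewrite -ia.
have tj j : 0 < j < k -> (M j, j) \in top g.
  move=> jk; have /mapP[p pt pE] := tM _ jk.
  have [_ p2 _ _] := canP _ _ ct pt.
  suff -> : (M j, j) = p by [].
  rewrite [p]surjective_pairing -pE p2 -pE mark_of_bound //.
  by case/andP: jk => -> /ltnW.
(* [M j] is an upper bound for the top parts of mark [j] and is one of them. *)
have gM j : j <= k -> mark_bound k g j = M j.
  rewrite /mark_bound; case: eqP => [-> //|j0].
  case: eqP => [-> //|jk] le.
  apply/eqP; rewrite eqn_leq; apply/andP; split.
    apply/bigmax_leqP_seq => p pt /eqP pj.
    by have [_ _ _ /andP[_]] := canP _ _ ct pt; rewrite pj.
  have jt : (M j, j) \in top g.
    by apply: tj; rewrite lt0n ltn_neqAle le andbT; apply/andP; split; apply/eqP.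
  by apply: (@leq_bigmax_seq _ (top g) (fun p => p.2 == j) fst (M j, j)).
have rowP (r : Defs.row) :
    marked_by (M k).-1 (mark_of k M) r ->
    all (fun a => 0 < a < peak g) (parts r) /\
    all (fun j => 0 < j <= k) (marks r).
  move=> cr; split; apply/allP => _ /mapP[p pr ->];
  by have [p1 _ p2 _] := canP _ _ cr pr; rewrite // peakM.
have sorted_marks (r : Defs.row) : sorted gtn (parts r) ->
    marked_by (M k).-1 (mark_of k M) r ->
    sorted geq (marks r).
  rewrite /parts /marks !sorted_map !sorted_pairwise; first last.
  - by move=> a b c /=; lia.
  - by move=> a b c /=; lia.
  elim: r => //= p r IHr /andP[/allP p1 r1] /andP[pc rc].
  rewrite IHr // andbT; apply/allP => q qr.
  have cr : marked_by (M k).-1 (mark_of k M) (p :: r) by rewrite /= pc.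
  have [p10 p2 _ _] := canP _ _ cr (mem_head _ _).
  have [q10 q2 _ _] := canP _ _ rc qr.
  change (q.2 <= p.2); rewrite p2 q2.
  apply: (mark_of_le M0 M_lt); first by case/andP: q10.
    exact: ltnW (p1 _ qr).
  by apply: ltnW; case/andP: p10.
have [tP tk] := rowP _ ct; have [bP bk] := rowP _ cb.
split=> //; apply/and4P; split=> //.
  by apply/and5P; split => //; rewrite peakM.
apply/implyP => k2; apply/and4P; split; [exact: sorted_marks..| |].
  apply/allP => j; rewrite mem_iota => jk.
  apply: (map_f snd (tj _ _)); move: jk k2; clear; lia.
apply/allP => p pb.
have [p1 _ p2 pI] := canP _ _ cb pb.
rewrite /mark_interval; case/andP: p2 => p20 pk.
rewrite !gM ?leq_pred // 1?(leq_trans (leq_pred _) pk) //.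
(* For mark [k] the required interval stops one short of the peak, which holds because all parts are
   below the peak. *)
by case: eqP pI => // ->; rewrite leq_predE //; case/andP: p1 => _ -> /andP[->].
Qed.

End MarkedSymbolStructure.

(** * The summand of the series as a product over possible parts *)

Section ProductExpansion.

Local Open Scope ring_scope.

Lemma partial_sum0 k (m : {ffun 'I_k -> nat}) : partial_sum m 0 = 0%N.
Proof. by rewrite /partial_sum big_pred0_eq. Qed.

Lemma partial_sumS k (m : {ffun 'I_k -> nat}) (j : 'I_k) :
  partial_sum m j.+1 = (partial_sum m j + m j)%N.
Proof.
rewrite /partial_sum (bigD1 j) //= addnC; congr addn.
by apply: eq_bigl => i; rewrite ltnS -val_eqE /= ltn_neqAle andbC.
Qed.

Lemma partial_sum_lt k (m : {ffun 'I_k -> nat}) j :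
  (forall i, 0 < m i)%N -> (j < k)%N -> (partial_sum m j < partial_sum m j.+1)%N.
Proof.
by move=> m0 jk; rewrite (partial_sumS m (Ordinal jk)) -addn1 leq_add2l.
Qed.

(** With [d = M j] and [n = m j], the exponents run through the integers strictly between [M j] and
    [M j.+1]. *)
Lemma qpochE (R : comNzRingType) (c : R) (d n : nat) : (0 < n)%N ->
  qpoch (- (c *: 'X^(d.+1))) 'X n.-1 =
  \prod_(1 <= i < n) (1 + c *: 'X^(i + d)).
Proof.
move=> n0; rewrite /qpoch prednK //; apply: eq_big_nat => -[//|i] _ /=.
by rewrite mulNr opprK -scalerAl -exprD addSnnS addnC.
Qed.

Lemma prod_nat_telescope (R : comNzRingType) (M : nat -> nat) (h : nat -> R) n :
  (forall j, (j < n)%N -> (M j <= M j.+1)%N) ->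
  \prod_((M 0%N).+1 <= a < (M n).+1) h a =
  \prod_(j < n) \prod_((M j).+1 <= a < (M j.+1).+1) h a.
Proof.
elim: n => [|n IHn] leM; first by rewrite big_ord0 big_geq.
rewrite big_ord_recr /= -IHn; last by move=> j jn; apply: leM; exact: ltnW.
rewrite (@big_cat_nat _ _ _ (M n).+1) ?ltnS ?leM //.
elim: n leM {IHn} => // n IHn leM.
by apply: leq_trans (leM n _) => //; apply: IHn => j jn; apply: leM; exact: ltnW.
Qed.

Variables (R : fieldType) (k : nat) (x : 'I_k -> R).
Variable m : {ffun 'I_k -> nat}.

Let M := partial_sum m.

Hypothesis x_neq0 : forall j, x j != 0.
Hypothesis m_gt0 : forall j, (0 < m j)%N.

(* [a != M (mk a)] removes the constant term at the bounds, which are forced to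
   be parts of the top row. *)
Lemma Uk_termE (y : nat -> R) : (0 < k)%N -> (forall j : 'I_k, y j.+1 = x j) ->
  let mk := mark_of k M in
  Uk_term x m =
  (\prod_(j < k | (j.+1 < k)%N) (x j)^-1) *:
  ('X^(M k) *
   \prod_(1 <= a < M k)
     (((a != M (mk a))%:R + y (mk a) *: 'X^a) * (1 + (y (mk a))^-1 *: 'X^a))).
Proof.
move=> k0 yx mk.
have M0 : M 0 = 0%N by exact: partial_sum0.
have M_lt j : (j < k)%N -> (M j < M j.+1)%N by exact: partial_sum_lt.
have M_le := bounds_le M_lt.
pose TB a := ((a != M (mk a))%:R + y (mk a) *: 'X^a) *
  (1 + (y (mk a))^-1 *: 'X^a).
(* Setting the factor at the peak to 1 lets the product run up to [M k], so that it splits into the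
   full blocks ending at [M 1], ..., [M k]. *)
pose h a := if a == M k then 1 else TB a.
pose bl (j : 'I_k) := \prod_(1 <= i < m j)
  ((1 + x j *: 'X^(i + M j)) * (1 + (x j)^-1 *: 'X^(i + M j))).
have block (j : 'I_k) : \prod_((M j).+1 <= a < (M j.+1).+1) h a =
    bl j * (if (j.+1 < k)%N
            then x j *: 'X^(M j.+1) * (1 + (x j)^-1 *: 'X^(M j.+1)) else 1).
  have Mj := M_lt _ (ltn_ord j).
  rewrite big_nat_recr //=; congr (_ * _); last first.
    have [jk|jk] := ltnP j.+1 k.
      rewrite /h ltn_eqF; last exact: leq_trans (M_lt _ jk) (M_le _ _ jk (leqnn k)).
      have mkM : mk (M j.+1) = j.+1.
        by apply: mark_of_bound => //; rewrite /= ltnW.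
      by rewrite /TB mkM yx eqxx add0r.
    have -> : j.+1 = k by apply/eqP; rewrite eqn_leq jk andbT.
    by rewrite /h eqxx.
  have mj : m j = (M j.+1 - M j)%N by rewrite /M partial_sumS addKn.
  rewrite /bl mj -[in LHS]add1n big_addn; apply: eq_big_nat => i /andP[i1 ij].
  have iM : (M j < i + M j < M j.+1)%N by lia.
  have mkE : mk (i + M j)%N = j.+1.
    apply: mark_of_unique => //=.
    by case/andP: iM => -> /ltnW.
  rewrite /h /TB mkE yx ltn_eqF; last first.
    by case/andP: iM => _ /leq_trans; apply; apply: M_le.
  by rewrite ltn_eqF //; case/andP: iM.
have -> : \prod_(1 <= a < M k) TB a = \prod_(j < k) (bl j *
    (if (j.+1 < k)%N
     then x j *: 'X^(M j.+1) * (1 + (x j)^-1 *: 'X^(M j.+1)) else 1)).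
  rewrite -(eq_bigr _ (fun j _ => block j)) -prod_nat_telescope; last first.
    by move=> j jk; exact: ltnW (M_lt _ jk).
  rewrite M0 big_nat_recr /=; last first.
    by have := M_lt _ k0; have := M_le _ _ k0 (leqnn k); rewrite M0; lia.
  rewrite {2}/h eqxx mulr1; apply: eq_big_nat => a /andP[_ aM].
  by rewrite /h ltn_eqF.
rewrite big_split /= -big_mkcond /= /Uk_term -/M.
set Q := \prod_(j < k | (j.+1 < k)%N) (1 + _).
have -> : \prod_(j < k | (j.+1 < k)%N)
    (x j *: 'X^(M j.+1) * (1 + (x j)^-1 *: 'X^(M j.+1))) =
    (\prod_(j < k | (j.+1 < k)%N) x j) *:
    (\prod_(j < k | (j.+1 < k)%N) 'X^(M j.+1) * Q).
  by rewrite scalerAl -scaler_prod -big_split.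
(* The exponents [M j.+1] with [j.+1 < k] come from the forced top parts, and [M k] from the
   peak. *)
have -> : 'X^(\sum_(1 <= j < k.+1) M j) =
    \prod_(j < k | (j.+1 < k)%N) 'X^(M j.+1) * 'X^(M k) :> {poly R}.
  rewrite big_add1 /= big_mkord.
  have kk : (k.-1 < k)%N by rewrite prednK.
  rewrite prodrXr -exprD; congr (_ ^+ _).
  rewrite (bigD1 (Ordinal kk)) //= addnC prednK //; congr addn.
  apply: eq_bigl => i; rewrite -val_eqE /=; have := ltn_ord i; lia.
(* Since [M 0 = 0], the pair of q-Pochhammer symbols for [j = 0] has the same form as the others. *)
rewrite -[LHS]mulrA; set B := (X in _ * X = _).
have -> : B = \prod_(j < k) bl j.
  rewrite [RHS](bigID (fun j : 'I_k => j == 0 :> nat)) /=; congr (_ * _).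
    apply: eq_bigr => j /eqP j0.
    have qE (c : R) : qpoch (- (c *: 'X)) 'X (m j).-1 =
        \prod_(1 <= i < m j) (1 + c *: 'X^(i + M j)).
      by rewrite j0 M0 -(qpochE c 0) // expr1.
    by rewrite !qE -big_split.
  apply: eq_big => [j|j _]; first by rewrite lt0n.
  by rewrite !qpochE // -big_split.
(* The prefactors [(x j)^-1] cancel the [x j] carried by the forced top parts. *)
rewrite -!scalerAr scalerA -big_split /=.
rewrite [X in X *: _]big1 ?scale1r; last by move=> j _; rewrite mulVf.
by rewrite [RHS]mulrCA [LHS]mulrC; congr (_ * _); rewrite -mulrA mulrCA.
Qed.

End ProductExpansion.

(** * Rank monomials as products over parts *)

Section SymbolWeights.

Local Open Scope ring_scope.

Variables (R : fieldType) (k : nat) (x : 'I_k -> R) (y : nat -> R).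

Hypothesis x_neq0 : forall j, x j != 0.
Hypothesis y_succ : forall j : 'I_k, y j.+1 = x j.

Definition symbol_weight (g : symbol) : R :=
  \prod_(j < k) x j ^ symbol_rank k g j.+1.

(** Here [y] is [x] reindexed by the marks 1, ..., k. Each part raises the exponent belonging to its
    own mark by one. *)
Lemma prod_marks (r : Defs.row) : all (fun j => 1 <= j <= k)%N (marks r) ->
  \prod_(p <- r) y p.2 = \prod_(j < k) x j ^+ num_marked r j.+1.
Proof.
elim: r => [_|[a i] r IHr /= /andP[/andP[i0 ik] rk]].
  by rewrite big_nil big1.
rewrite big_cons IHr // /num_marked /=.
have ik' : (i.-1 < k)%N by rewrite prednK.
under [RHS]eq_bigr do rewrite exprD.
rewrite big_split /=; congr (_ * _).
rewrite (bigD1 (Ordinal ik')) //= -y_succ /= prednK // eqxx expr1.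
rewrite big1 ?mulr1 // => j; rewrite -val_eqE /= => ji.
by case: eqP => // ij; case/eqP: ji; rewrite ij.
Qed.

Lemma symbol_weightE g :
  all (fun j => 1 <= j <= k)%N (marks (top g)) ->
  all (fun j => 1 <= j <= k)%N (marks (bottom g)) ->
  symbol_weight g = \prod_(j < k | (j.+1 < k)%N) (x j)^-1 *
    (\prod_(p <- top g) y p.2 * \prod_(p <- bottom g) (y p.2)^-1).
Proof.
move=> tk bk; rewrite prodfV !prod_marks // -prodfV -big_split /=.
rewrite [X in X * _]big_mkcond -big_split; apply: eq_bigr => j _ /=.
rewrite /symbol_rank !expfzDr // -exprnP -exprnN mulrC; congr (_ * _).
by case: ifP => _; rewrite ?oppr0 ?expr0z ?exprN1.
Qed.

End SymbolWeights.

(** * Symbols contributing to a single summand *)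

Section FixedBounds.

Local Open Scope ring_scope.
Local Open Scope classical_set_scope.

Variables (R : fieldType) (k : nat) (x : 'I_k -> R) (y : nat -> R).
Variable m : {ffun 'I_k -> nat}.

Hypothesis k_gt0 : (0 < k)%N.
Hypothesis x_neq0 : forall j, x j != 0.
Hypothesis y_succ : forall j : 'I_k, y j.+1 = x j.
Hypothesis m_gt0 : forall j, (0 < m j)%N.

Let M := partial_sum m.
Let N := (M k).-1.
Let mk := mark_of k M.

(** The two booleans of [f i] tell whether [i.+1] is a part of the top row and of the bottom row. *)
Definition symbol_of (f : {ffun 'I_N -> bool * bool}) : symbol :=
  Symbol (M k) (row_of mk (fun i => (f i).1)) (row_of mk (fun i => (f i).2)).

Definition has_bounds (f : {ffun 'I_N -> bool * bool}) : bool :=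
  [forall i : 'I_N, (i.+1 == M (mk i.+1)) ==> (f i).1].

(** Expanding the product means choosing one of four terms in each factor, which is the choice of
    [f]. *)
Lemma coef_Uk_term n :
  (Uk_term x m)`_n =
  \sum_(f : {ffun 'I_N -> bool * bool} |
        has_bounds f && (symbol_size (symbol_of f) == n))
    \prod_(j < k | (j.+1 < k)%N) (x j)^-1 *
    (\prod_(p <- top (symbol_of f)) y p.2 *
     \prod_(p <- bottom (symbol_of f)) (y p.2)^-1).
Proof.
rewrite (Uk_termE x_neq0 m_gt0 k_gt0 y_succ) -/M -/mk.
(* [c i b] and [e i b] are the coefficient and the exponent of the term that [b] selects in the
   factor of the part [i.+1]. *)
pose c (i : 'I_N) (b : bool * bool) : R :=
  (if b.1 then y (mk i.+1) else (i.+1 != M (mk i.+1))%:R) *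
  (if b.2 then (y (mk i.+1))^-1 else 1).
pose e (i : 'I_N) (b : bool * bool) :=
  ((if b.1 then i.+1 else 0) + (if b.2 then i.+1 else 0))%N.
have -> : \prod_(1 <= a < M k)
     (((a != M (mk a))%:R + y (mk a) *: 'X^a) * (1 + (y (mk a))^-1 *: 'X^a)) =
    \prod_(i < N) \sum_(b : bool * bool) c i b *: 'X^(e i b) :> {poly R}.
  rewrite big_add1 big_mkord; apply: eq_bigr => i _.
  rewrite -(pair_bigA _ (fun b1 b2 => c i (b1, b2) *: 'X^(e i (b1, b2)))) /=.
  rewrite !big_bool /c /e /= !mulr1 !addn0 !add0n expr0.
  rewrite exprD -scalerA -!mul_polyC polyCM.
  set Y := (y _)%:P; set Z := (_^-1)%:P; set W := 'X^_; set V := (_ != _).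
  by rewrite polyC_natr; ring.
rewrite bigA_distr_bigA mulr_sumr scaler_sumr coef_sum.
rewrite [RHS]big_mkcond; apply: eq_bigr => f _ /=.
rewrite scaler_prod -scalerAr scalerA coefZ prodrXr -exprD coefXn.
have -> : (M k + \sum_(i < N) e i (f i))%N = symbol_size (symbol_of f).
  rewrite /symbol_size !sumn_row_of /= -addnA.
  by rewrite !(big_mkcond (fun i => _ (f i))) -big_split.
rewrite (prod_row_of y) (prod_row_of (fun j => (y j)^-1)) eq_sym.
case: eqP => _; last by rewrite mulr0 andbF.
rewrite mulr1 andbT /c big_split /= -!big_mkcond /=.
have [/forallP hf|] := boolP (has_bounds f).
  rewrite (big_mkcond (fun i => (f i).1)) /=.
  congr (_ * (_ * _)); apply: eq_bigr => i _.
  have := hf i; case: (f i).1 => //=.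
  by rewrite implybF => ->.
(* A choice that omits a bound from the top row picks up a zero coefficient. *)
rewrite negb_forall => /existsP[i]; rewrite negb_imply => /andP[iM fi].
by rewrite (bigD1 i) //= (negbTE fi) iM /= !mul0r mulr0.
Qed.

(** The summation index of [Uk] to which the symbol contributes. *)
Definition bound_increments (g : symbol) : {ffun 'I_k -> nat} :=
  [ffun j : 'I_k => (mark_bound k g j.+1 - mark_bound k g j)%N].

Lemma symbol_of_bij n :
  set_bij [set` [pred f | has_bounds f && (symbol_size (symbol_of f) == n)]]
    ([set g | marked_symbol k g /\ symbol_size g = n] `&`
      bound_increments @^-1` [set m]) symbol_of.
Proof.
have M0 : M 0 = 0%N by exact: partial_sum0.
have M_lt j : (j < k)%N -> (M j < M j.+1)%N by exact: partial_sum_lt.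
have Mk0 : (0 < M k)%N.
  by have := M_lt _ k_gt0; have := bounds_le M_lt k_gt0 (leqnn k); lia.
split.
- move=> f /= /andP[/forallP hf /eqP sf].
  have [||||] // := @canonical_marked_symbol k M (symbol_of f) k_gt0 M0 M_lt.
  + exact: canonical_row_of.
  + exact: canonical_row_of.
  + move=> j /andP[j0 jk] /=.
    have Mj0 : (0 < M j)%N.
      by have := M_lt j.-1; rewrite prednK // => /(_ (ltnW jk)); lia.
    have jN : ((M j).-1 < N)%N.
      have := M_lt j jk; have := bounds_le M_lt jk (leqnn k).
      by rewrite /N; lia.
    have := parts_row_of mk (fun i => (f i).1) (Ordinal jN).
    rewrite /= prednK // => ->.
    have /implyP := hf (Ordinal jN); apply; rewrite /= prednK //.
    by rewrite /mk mark_of_bound // j0 ltnW.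
  move=> gk gM; split => //.
  apply/ffunP => j; rewrite ffunE !gM //; last exact: ltnW.
  by rewrite /M partial_sumS addKn.
- move=> f f' _ _ [/(congr1 (@parts)) ft /(congr1 (@parts)) fb].
  apply/ffunP => i; rewrite [f i]surjective_pairing [f' i]surjective_pairing.
  have := parts_row_of mk (fun i => (f i).1) i; rewrite ft parts_row_of => ->.
  by have := parts_row_of mk (fun i => (f i).2) i; rewrite fb parts_row_of => ->.
- move=> g /= [[gk gn] /= gm].
  (* The increments determine the bounds by induction from 0; truncated subtraction is exact because
     the bounds increase. *)
  have gM j : (j <= k)%N -> mark_bound k g j = M j.
    elim: j => [//|j IHj] jk.
    have := partial_sumS m (Ordinal jk); rewrite /= -/M => ->.
    rewrite -(IHj (ltnW jk)) -gm ffunE /= subnKC //.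
    exact: ltnW (mark_bound_lt gk jk).
  have [gP tc bc tM] := marked_symbol_canonical k_gt0 gk gM.
  pose f := [ffun i : 'I_N =>
    (i.+1 \in parts (top g), i.+1 \in parts (bottom g))].
  have gE : symbol_of f = g.
    transitivity (Symbol (peak g) (top g) (bottom g)); last by case: (g).
    rewrite /symbol_of gP; congr Symbol.
      rewrite [RHS](canonical_rowE tc) /row_of; congr map.
      by apply: eq_filter => i; rewrite ffunE.
    rewrite [RHS](canonical_rowE bc) /row_of; congr map.
    by apply: eq_filter => i; rewrite ffunE.
  exists f => //.
  change (has_bounds f && (symbol_size (symbol_of f) == n)).
  rewrite gE gn eqxx andbT.
  apply/forallP => i; apply/implyP => /eqP iM; rewrite ffunE /= iM.
  (* A bound equal to some [i.+1 < M k] has mark below [k], so it is one of the forced top parts. *)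
  have [|/andP[j0 jk] /andP[ij ji]] := @mark_ofP k M M0 i.+1.
    by have := ltn_ord i; rewrite {2}/N /=; lia.
  apply: tM; rewrite /mk j0 /= ltn_neqAle jk andbT.
  apply/eqP => jE; move: iM; rewrite /mk jE.
  by have := ltn_ord i; rewrite {2}/N; lia.
Qed.

Lemma coef_Uk_term_symbols n :
  (Uk_term x m)`_n =
  \sum_(g \in [set g | marked_symbol k g /\ symbol_size g = n] `&`
      bound_increments @^-1` [set m]) symbol_weight x g.
Proof.
rewrite (@reindex_fsbig _ _ _ _ _ symbol_of _ _ _ (symbol_of_bij n)).
rewrite coef_Uk_term.
rewrite [LHS]bigfs; first last.
- by move=> f _; rewrite mem_index_enum.
- exact: index_enum_uniq.
apply: eq_fsbigr => f; rewrite inE /= => fP.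
have [/(_ f fP) [/= [/and4P[_ tk bk _] _] _] _ _] := symbol_of_bij n.
by rewrite (symbol_weightE x_neq0 y_succ).
Qed.

End FixedBounds.

(** * Equality of the two series *)

Section GeneratingFunction.

Local Open Scope ring_scope.
Local Open Scope classical_set_scope.

Variables (R : fieldType) (k : nat) (x : 'I_k -> R).

Hypothesis k_gt0 : (0 < k)%N.
Hypothesis x_neq0 : forall j, x j != 0.

Definition marked_symbols_of_size (n : nat) : set symbol :=
  [set g | marked_symbol k g /\ symbol_size g = n].

Lemma bound_increments_gt0 g : marked_symbol k g -> Uk_index (bound_increments k g).
Proof. by move=> gk j; rewrite ffunE subn_gt0 mark_bound_lt. Qed.

(** The bounds are at most the peak, hence at most [n]. This leaves finitely many increment vectors,
    each with finitely many symbols by [symbol_of_bij]. *)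
Lemma finite_marked_symbols_of_size n : finite_set (marked_symbols_of_size n).
Proof.
pose S := [set m : {ffun 'I_k -> nat} | forall j, (0 < m j <= n)%N].
apply: (@sub_finite_set _ _
  (\bigcup_(m in S)
    (marked_symbols_of_size n `&` @bound_increments k @^-1` [set m]))).
  move=> g gA; have [gk gn] := gA.
  exists (bound_increments k g) => // j.
  rewrite (bound_increments_gt0 gk) /= ffunE.
  have incr i : (i <= k)%N -> (mark_bound k g i <= peak g)%N.
    move=> ik; rewrite -(mark_bound_peak g k_gt0).
    by apply: (bounds_le (k := k)) => // l lk; apply: mark_bound_lt.
  apply: leq_trans (leq_subr _ _) (leq_trans (incr _ (ltn_ord j)) _).
  by rewrite -gn /symbol_size -addnA leq_addr.
apply: bigcup_finite.
  apply: (@sub_finite_set _ _ (range (fun h : {ffun 'I_k -> 'I_n.+1} =>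
      [ffun j => val (h j)]))); last by apply: finite_image; exact: finite_finset.
  move=> m mS; exists [ffun j => inord (m j)] => //.
  apply/ffunP => j; rewrite !ffunE /= inordK // ltnS.
  by have /andP[] := mS j.
move=> m mS.
have m_gt0 j : (0 < m j)%N by have /andP[] := mS j.
have [_ _ sur] := symbol_of_bij k_gt0 m_gt0 n.
by apply: (sub_finite_set sur); apply: finite_image; exact: finite_finset.
Qed.

Definition rank_size (g : symbol) : {ffun 'I_k -> int} * nat :=
  ([ffun j : 'I_k => symbol_rank k g j.+1], symbol_size g).

(** All symbols in a fibre share the same rank monomial, so their weights add up to that monomial
    times their number. *)
Lemma coef_rank_term p n :
  (rank_term x p)`_n = \sum_(g \in marked_symbols_of_size n `&`
    rank_size @^-1` [set p]) symbol_weight x g.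
Proof.
case: p => r s; rewrite /rank_term coefZ coefXn /=.
have [->|ns] := eqVneq n s; last first.
  rewrite mulr0 fsbig1 // => g [[_ gn] /= [_ gs]].
  by case/eqP: ns; rewrite -gn -gs.
rewrite mulr1.
have -> : marked_symbols_of_size s `&` rank_size @^-1` [set (r, s)] =
    symbols_with_ranks r s.
  apply/seteqP; split=> g /=.
    by move=> [[gk gs] [gr _]]; split=> // j; rewrite -gr ffunE.
  move=> [gk gs gr]; split=> //; rewrite /rank_size gs; congr (_, _).
  by apply/ffunP => j; rewrite ffunE.
have finS := finite_symbols_with_ranks r s.
rewrite fsbig_finite //.
rewrite [RHS](eq_big_seq (fun _ => \prod_(j < k) x j ^ r j)); last first.
  move=> g; rewrite in_fset_set // inE => -[_ _ gr].
  by apply: eq_bigr => j _; rewrite gr.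
by rewrite big_const_seq count_predT iter_addr addr0 mulr_natl.
Qed.

Lemma rank_size_index n g : marked_symbols_of_size n g ->
  @rank_index k (rank_size g).
Proof.
move=> [/and4P[/and5P[P1 _ _ _ _] _ _ _] _].
by rewrite /rank_index /= /symbol_size -addnA (leq_trans P1) ?leq_addr.
Qed.

Lemma coef_Uk_term_index m n : Uk_index m ->
  (Uk_term x m)`_n = \sum_(g \in marked_symbols_of_size n `&`
    @bound_increments k @^-1` [set m]) symbol_weight x g.
Proof.
move=> m_gt0.
(* [y] shifts marks to indices in ['I_k], with default value 1 for marks above [k]. *)
apply: (coef_Uk_term_symbols (y := fun j => oapp x 1 (insub j.-1))) => // j.
by rewrite /= valK.
Qed.

(** Each side of the identity groups the same finite sum of weights along a different map [f]:
    [rank_size] for the rank series, [bound_increments] for [Uk]. *)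
Lemma fps_sum_fibers (J : choiceType) (D : set J) (F : J -> {poly R})
    (f : symbol -> J) :
  (forall n g, marked_symbols_of_size n g -> D (f g)) ->
  (forall j n, D j -> (F j)`_n = \sum_(g \in marked_symbols_of_size n `&`
    f @^-1` [set j]) symbol_weight x g) ->
  fps_summable D F /\
  fps_sum D F =
    fun n => \sum_(g \in marked_symbols_of_size n) symbol_weight x g.
Proof.
move=> Df FE; split=> [n|].
  apply: sub_finite_set (finite_fiber_sum_support D f (symbol_weight x)
    (finite_marked_symbols_of_size n)) => j [Dj].
  by rewrite FE.
apply/funext => n; rewrite /fps_sum.
rewrite -(fsbig_partition _ (finite_marked_symbols_of_size n) (Df n)).
by apply: eq_fsbigr => j /set_mem Dj; rewrite FE.
Qed.

Lemma rank_generating_function :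
  [/\ fps_summable (@rank_index k) (rank_term x),
      fps_summable (@Uk_index k) (Uk_term x) &
      fps_sum (@rank_index k) (rank_term x) = Uk x].
Proof.
have [sr er] := fps_sum_fibers rank_size_index
  (fun p n _ => coef_rank_term p n).
have [su eu] := @fps_sum_fibers _ (@Uk_index k) (Uk_term x) (@bound_increments k)
  (fun n g gA => bound_increments_gt0 gA.1)
  (fun m n mI => coef_Uk_term_index n mI).
by split; rewrite // er /Uk eu.
Qed.

End GeneratingFunction.

Theorem theorem1p2 (k : nat) (hk : (1 <= k)%N) :
  [/\ fps_summable (@rank_index k) (rank_term (@laurent_var k)),
      fps_summable (@Uk_index k) (Uk_term (@laurent_var k)) &
      fps_sum (@rank_index k) (rank_term (@laurent_var k))
        = Uk (@laurent_var k)].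
Proof.
apply: rank_generating_function => // j.
(* The variables are nonzero fractions: the coefficient of ['X_j] at its own monomial is 1. *)
rewrite /laurent_var tofrac_eq0; apply/eqP => /(congr1 (mcoeff U_(j)%MM)).
by rewrite mcoeffX eqxx mcoeff0.
Qed.
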